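(* There exist universal constants $A,a>0$ such that for every $\varepsilon\ge0$, every integer $S\ge2$ and every positive integer $n\ge e^{\varepsilon}S$, $$a\,\frac{e^\varepsilon S}{n}\;\le\;\sup_{P,Q\in\mathcal{M}_S}\mathbb{E}_Q\big[|d_\varepsilon(P\|Q_n)-d_\varepsilon(P\|Q)|^2\big]\;\le\;A\,\frac{e^\varepsilon S}{n}.$$
   Context: $\mathcal{M}_S$ is the set of probability distributions on $[S]=\{1,\dots,S\}$. $[x]^+=\max\{x,0\}$. For nonnegative vectors $P=(p_i)_{i=1}^S$, $Q=(q_i)_{i=1}^S$ (not necessarily summing to one), $d_\varepsilon(P\|Q)=\sum_{i=1}^S[p_i-e^\varepsilon q_i]^+$. Sampling model (Poisson sampling, expected sample size $n$): a random number $N\sim\mathrm{Poi}(n)$ of i.i.d. samples is drawn from $Q$, and $Q_n=(\hat q_1,\dots,\hat q_S)$, where $\hat q_i$ is the number of samples equal to $i$ divided by $n$ (not by $N$). Equivalently, $\hat q_1,\dots,\hat q_S$ are independent with $n\hat q_i\sim\mathrm{Poi}(nq_i)$. $P$ is known; $\mathbb{E}_Q$ is expectation over $Q_n$. *)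

(* Defs.v *)
From HB Require Import structures.
From mathcomp Require Import all_boot all_order all_algebra.
From mathcomp Require Import all_classical all_reals all_analysis.

Set Implicit Arguments.
Unset Strict Implicit.
Unset Printing Implicit Defensive.

Import Order.TTheory GRing.Theory Num.Theory.

Local Open Scope classical_set_scope.
Local Open Scope ring_scope.

Definition simplex (R : realType) (S : nat) : set ('I_S -> R) :=
  [set p | (forall i, 0 <= p i) /\ \sum_(i < S) p i = 1].
Arguments simplex R S : clear implicits.

Definition hockey_stick (R : realType) (S : nat) (eps : R) (p q : 'I_S -> R)
    : R :=
  \sum_(i < S) Num.max (p i - expR eps * q i) 0.

Section finite_product.
Context {d : measure_display} {T : measurableType d} {R : realType}.

Definition cons_pair (n : nat) (x : T * n.-tuple T) : n.+1.-tuple T :=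
  [tuple of x.1 :: x.2].

Lemma measurable_cons_pair (n : nat) : measurable_fun setT (@cons_pair n).
Proof. exact: measurable_cons. Qed.

HB.instance Definition _ (n : nat) :=
  isMeasurableFun.Build _ _ _ _ (@cons_pair n) (@measurable_cons_pair n).

Fixpoint prod_prob (n : nat) :
    ('I_n -> probability T R) -> probability (n.-tuple T) R :=
  match n with
  | 0 => fun=> \d_[tuple]
  | n'.+1 => fun mu =>
      distribution (mu ord0 \x prod_prob (fun i => mu (lift ord0 i)))%E
        (@cons_pair n')
  end.

(* prod_prob mu is the product measure: under it the coordinates are
   independent, the i-th one having law mu i. *)
Lemma prod_probE (n : nat) (mu : 'I_n -> probability T R)
    (A : 'I_n -> set T) : (forall i, measurable (A i)) ->
  prod_prob mu [set x | forall i, A i (tnth x i)] =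
    (\prod_(i < n) mu i (A i))%E.
Proof.
elim: n mu A => [|n IH] mu A mA.
  by rewrite big_ord0 /= diracE mem_set// => -[].
rewrite big_ord_recl -(IH (fun i => mu (lift ord0 i)))//.
have mB : measurable [set y : n.-tuple T |
    forall i, A (lift ord0 i) (tnth y i)].
  rewrite (_ : mkset _ = \bigcap_(i in [set: 'I_n])
      ((fun y : n.-tuple T => tnth y i) @^-1` A (lift ord0 i))); last first.
    by apply/seteqP; split => y /= Ay i => [_|]; exact: Ay.
  apply: fin_bigcap_measurable => [|i _]; first exact: finite_finset.
  have mt : measurable_fun setT (fun y : n.-tuple T => tnth y i).
    exact: measurable_tnth.
  rewrite -[_ @^-1` _]setTI; exact: (mt measurableT _ (mA _)).
rewrite -product_measure1E//= /distribution /pushforward.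
rewrite [X in (_ \x _)%E X = _](_ : _ =
    A ord0 `*` [set y : n.-tuple T | forall i, A (lift ord0 i) (tnth y i)])//.
apply/seteqP; split => -[x y] /=.
  move=> Axy; split=> [|i]; first by have := Axy ord0.
  by have := Axy (lift ord0 i); rewrite tnthS.
move=> [Ax Ay] i; case: (unliftP ord0 i) => [j ->|->]; last by rewrite tnth0.
by rewrite tnthS; exact: Ay.
Qed.
End finite_product.

Section poisson_sampling.
Context {R : realType} {S : nat}.

(* Under Poisson sampling (Poi(n) many i.i.d. draws from q), the numbers of
   occurrences of the S symbols are independent, the i-th one being
   Poi(n * q i); this is their joint law. The library's poisson_prob takes an
   unused nat argument, here 0; for rate 0 it is the Dirac mass at 0. *)
Definition poisson_counts (n : nat) (q : 'I_S -> R)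
    : probability (S.-tuple nat) R :=
  prod_prob (fun i => poisson_prob (n%:R * q i) 0%N).

(* Counts are divided by the expected sample size n, not by the realized total
   count, so the result need not sum to 1. *)
Definition empirical (n : nat) (x : S.-tuple nat) : 'I_S -> R :=
  fun i => (tnth x i)%:R / n%:R.

Definition plugin_risk (eps : R) (n : nat) (p q : 'I_S -> R) : \bar R :=
  ('E_(poisson_counts n q)[fun x =>
    (`|hockey_stick eps p (empirical n x) - hockey_stick eps p q| ^+ 2)%R])%E.
End poisson_sampling.

(* Main.v *)
From HB Require Import structures.
Require Import Defs.
From mathcomp Require Import all_boot all_order all_algebra.
From mathcomp Require Import all_classical all_reals all_analysis.
From mathcomp Require Import measurable_realfun ring lra.

(* Write c = e^eps and let f_i = [p_i - c X_i/n]^+, g_i = [p_i - c q_i]^+, with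
   X_i ~ Poi(n q_i).

   Upper bound: q_i (f_i - g_i)^2 <= 2 c p_i (X_i/n - q_i)^2 holds pointwise. If
   c q_i <= 2 p_i it follows from f being c-Lipschitz; otherwise g_i = 0, and
   f_i <= p_i is nonzero only when c X_i/n < p_i < c q_i/2. Taking expectations,
   E (f_i - g_i)^2 <= 2 c p_i/n, and Cauchy-Schwarz over the S symbols gives
   2 c S/n.

   Lower bound: take p uniform and q_i = p_i/c for all symbols but the last,
   which gets the remaining mass. Then d_eps(P || Q) = 0, so all g_i vanish and
   the risk is at least the square of sum_i E f_i. For i < S,
   E f_i = (c/n) E [lam - X]^+ with X ~ Poi(lam), lam = n/(c S) >= 1, and
   E [lam - X]^+ >= (3/32) sqrt lam by comparing the second and fourth central
   moments of X. *)

Import Order.TTheory GRing.Theory Num.Theory.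

Local Open Scope classical_set_scope.
Local Open Scope ring_scope.

(** * Factorial moments of the Poisson law *)

Section poisson_moments.
Context {R : realType} (rate : R).
Hypothesis rate_gt0 : 0 < rate.
Local Notation poisson := (poisson_prob rate 0).

(** For a positive rate the Poisson measure is a countable sum of Dirac masses weighted by
    [poisson_pmf]. *)
Lemma ge0_integral_poisson (f : nat -> R) : (forall k, 0 <= f k) ->
  (\int[poisson]_x (f x)%:E = \sum_(k <oo) (poisson_pmf rate k * f k)%:E)%E.
Proof.
move=> f0; pose w k := NngNum (poisson_pmf_ge0 rate k).
rewrite (@eq_measure_integral _ _ _ _ (mseries (fun k => mscale (w k) \d_k) 0)).
  rewrite (@ge0_integral_measure_series _ _ _ (fun k => mscale (w k) \d_k))//.
  - apply: eq_eseriesr => k _.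
    rewrite ge0_integral_mscale//=.
      by rewrite integral_dirac//= diracT mul1e.
    by move=> ? _; rewrite lee_fin.
  - by move=> t _; rewrite lee_fin.
move=> A _ _; rewrite /= /mseries /poisson_prob rate_gt0 esum_mkcond.
rewrite -nneseries_esumT => [|k]; last first.
  by case: ifP; rewrite // lee_fin poisson_pmf_ge0.
apply: eq_eseriesr => k _.
rewrite [RHS](_ : _ = (poisson_pmf rate k)%:E * (\1_A k)%:E)%E// indicE.
by case: ifP; rewrite ?mule1 ?mule0.
Qed.

(** The Chen-Stein identity: (k+1) pmf(k+1) = rate pmf(k). The value of [x.-1] at 0 is harmless
    because of the factor x. *)
Lemma integral_poisson_shift (g : nat -> R) : (forall k, 0 <= g k) ->
  (\int[poisson]_x (x%:R * g x.-1)%:E = rate%:E * \int[poisson]_x (g x)%:E)%E.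
Proof.
move=> g0; rewrite !ge0_integral_poisson//; last by move=> k; rewrite mulr_ge0.
rewrite nneseries_recl//; last first.
  by move=> k _; rewrite lee_fin !mulr_ge0// poisson_pmf_ge0.
rewrite mul0r mulr0 add0e -nneseries_addn; last first.
  by move=> k; rewrite lee_fin !mulr_ge0// poisson_pmf_ge0.
rewrite -nneseriesZl; last first.
  by move=> k _; rewrite lee_fin mulr_ge0// poisson_pmf_ge0.
apply: eq_eseriesr => k _; rewrite addn1 /= -EFinM /poisson_pmf rate_gt0.
congr EFin; rewrite factS natrM exprS.
have k1 : (k.+1%:R : R) != 0 by rewrite pnatr_eq0.
have kf : (k`!%:R : R) != 0 by rewrite pnatr_eq0 -lt0n fact_gt0.
by field; rewrite kf nat1r k1.
Qed.

Lemma integral_poisson_ffact (m : nat) :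
  (\int[poisson]_x ((x ^_ m)%:R)%:E = (rate ^+ m)%:E :> \bar R)%E.
Proof.
elim: m => [|m IH].
  under eq_integral do rewrite ffactn0.
  by rewrite (integral_cst _ measurableT 1%:E) mul1e; exact: probability_setT.
under eq_integral do rewrite ffactnS natrM.
rewrite (integral_poisson_shift (fun x => (x ^_ m)%:R))//.
by rewrite IH -EFinM exprS.
Qed.

Lemma integrable_poisson_ffact (a : R) (m : nat) :
  (poisson_prob rate 0).-integrable setT (fun x => (a * (x ^_ m)%:R)%:E).
Proof.
under eq_fun do rewrite EFinM.
apply: integrableZl => //; apply/integrableP; split => //.
under eq_integral do rewrite gee0_abs ?lee_fin//.
by rewrite integral_poisson_ffact ltry.
Qed.

Lemma integrable_poisson_ffact_sum (m : nat) (a : nat -> R) :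
  (poisson_prob rate 0).-integrable setT
    (fun x => (\sum_(i < m) a i * (x ^_ i)%:R)%:E).
Proof.
under eq_fun do rewrite -sumEFin.
by apply: integrable_sum => // i _; exact: integrable_poisson_ffact.
Qed.

(** In the falling factorial basis, taking a Poisson expectation amounts to replacing [x ^_ i] by
    [rate ^+ i]; the polynomial moments below are computed by expanding in this basis. *)
Lemma integral_poisson_ffact_sum (m : nat) (a : nat -> R) :
  (\int[poisson]_x (\sum_(i < m) a i * (x ^_ i)%:R)%:E
   = (\sum_(i < m) a i * rate ^+ i)%:E)%E.
Proof.
under eq_integral do rewrite -sumEFin.
rewrite integral_sum//; last by move=> i; exact: integrable_poisson_ffact.
rewrite -sumEFin; apply: eq_bigr => i _.
under eq_integral do rewrite EFinM.
rewrite integralZl//; first by rewrite integral_poisson_ffact.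
have := integrable_poisson_ffact 1 i.
by under eq_fun do rewrite mul1r.
Qed.

End poisson_moments.

(** The i-th marginal of the product is [mu i]: apply [prod_probE] to the box with A in coordinate i
    and the full space, of mass 1, elsewhere. *)
Lemma integral_prod_prob_tnth (d : measure_display)
    (T : measurableType d) (R : realType) (n : nat)
    (mu : 'I_n -> probability T R) (i : 'I_n) (f : T -> \bar R) :
  measurable_fun [set: T] f -> (forall x, 0 <= f x)%E ->
  (\int[prod_prob mu]_x f (tnth x i) = \int[mu i]_x f x)%E.
Proof.
move=> mf f0.
have mt : measurable_fun setT (fun x : n.-tuple T => tnth x i).
  exact: measurable_tnth.
pose X : {mfun n.-tuple T >-> T} := HB.pack (fun x : n.-tuple T => tnth x i)
  (isMeasurableFun.Build _ _ _ _ _ mt).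
rewrite -(@ge0_integral_distribution _ _ _ _ _ (prod_prob mu) X f mf f0).
apply: eq_measure_integral => A mA _; rewrite /distribution /pushforward/=.
pose B j := if j == i then A else setT.
transitivity (prod_prob mu [set x | forall j, B j (tnth x j)]).
  congr (prod_prob mu _); apply/seteqP; split => x /=.
    by move=> Ax j; rewrite /B; case: eqP => // ->.
  by move/(_ i); rewrite /B eqxx.
rewrite prod_probE; last by move=> j; rewrite /B; case: ifP.
rewrite (bigD1 i)//= /B eqxx big1 ?mule1// => j /negbTE ->.
exact: probability_setT.
Qed.

(** * Variance and mean deficit of a Poisson variable *)

Lemma natr_ffactSr (R : nzRingType) (x m : nat) :
  (x ^_ m.+1)%:R = (x ^_ m)%:R * (x%:R - m%:R) :> R.
Proof.
(* For x < m the truncated subtraction is not the ring one, but then [x ^_ m] is already zero. *)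
rewrite ffactnSr natrM; have [xm|mx] := ltnP x m.
  by rewrite ffact_small// !mul0r.
by rewrite natrB.
Qed.

Lemma integral_poisson_variance (R : realType) (rate : R) : 0 < rate ->
  (\int[poisson_prob rate 0]_x ((x%:R - rate) ^+ 2)%:E = rate%:E)%E.
Proof.
move=> rate0.
(* (x - rate)^2 = x(x-1) + (1 - 2 rate) x + rate^2. *)
have := integral_poisson_ffact_sum rate rate0 3
  (nth 0 [:: rate ^+ 2; 1 - 2 * rate; 1]).
rewrite !big_ord_recr big_ord0/= [in RHS](_ : _ + _ = rate); last by ring.
move=> <-; apply: eq_integral => x _; congr EFin.
rewrite !big_ord_recr big_ord0/= !natr_ffactSr ffactn0; ring.
Qed.

(* [y^2 u - y^4 u^3 <= |y|] turns the second and fourth moments into a lower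
   bound on the first absolute moment, of which the deficit is half. *)
Lemma deficit_ge_poly (R : realFieldType) (u y : R) : 0 <= u ->
  (y ^+ 2 * u - y ^+ 4 * u ^+ 3 - y) / 2 <= Num.max (- y) 0.
Proof.
move=> u0.
have key (m : R) : 0 <= m -> m ^+ 2 * u - m ^+ 4 * u ^+ 3 <= m.
  move=> m0; have v0 : 0 <= m * u by rewrite mulr_ge0.
  have : 0 <= 1 - m * u + (m * u) ^+ 3.
    move: (m * u) v0 => v v0; have v3 := exprn_ge0 3 v0.
    by have [v1|v1] := leP v 1; [lra|nra].
  move=> /(mulr_ge0 m0); lra.
rewrite maxEle; case: ifP => y0.
  have {}y0 : 0 <= y by lra.
  by have := key _ y0; lra.
have {}y0 : 0 <= - y by lra.
by have := key _ y0; lra.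
Qed.

Lemma integral_poisson_deficit_ge (R : realType) (rate : R) : 1 <= rate ->
  ((3 / 32 * Num.sqrt rate)%:E <=
   \int[poisson_prob rate 0]_x (Num.max (rate - x%:R) 0)%:E)%E.
Proof.
move=> rate1; have rate0 : 0 < rate by lra.
set r := Num.sqrt rate.
have rE : rate = r ^+ 2 by rewrite sqr_sqrtr// ltW.
have r0 : 0 < r by rewrite sqrtr_gt0.
have r1 : 1 <= r by rewrite -sqrtr1 ler_wsqrtr.
(* With u of order 1/r, both y^2 u and y^4 u^3 have mean of order r; the factor 4 keeps the
   difference positive. *)
pose u := (4 * r)^-1.
have u0 : 0 <= u by rewrite invr_ge0; lra.
(* The coefficients, in the falling factorial basis, of the polynomial of
   deficit_ge_poly at y = x - rate. *)
pose a := nth 0 [::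
  (rate ^+ 2 * u - rate ^+ 4 * u ^+ 3 + rate) / 2;
  ((1 - 2 * rate) * u
    - (1 - 4 * rate + 6 * rate ^+ 2 - 4 * rate ^+ 3) * u ^+ 3 - 1) / 2;
  (u - (7 - 12 * rate + 6 * rate ^+ 2) * u ^+ 3) / 2;
  - (6 - 4 * rate) * u ^+ 3 / 2;
  - u ^+ 3 / 2].
apply: (@le_trans _ _
    (\int[poisson_prob rate 0]_x (\sum_(i < 5) a i * (x ^_ i)%:R)%:E)%E).
  rewrite integral_poisson_ffact_sum// lee_fin !big_ord_recr big_ord0/=.
  (* The central moments of orders 1, 2 and 4 are 0, rate and 3 rate^2 + rate. Since 1/r <= 1 <= r,
     the result is at least (12/128) r = (3/32) r. *)
  rewrite [leRHS](_ : _ = (rate * u - (3 * rate ^+ 2 + rate) * u ^+ 3) / 2);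
    last by rewrite /a/=; ring.
  rewrite /u rE.
  rewrite [leRHS](_ : _ = 13 / 128 * r - 1 / 128 * r^-1); last first.
    by field; rewrite gt_eqF.
  have : r^-1 <= 1 by rewrite invf_le1.
  lra.
apply: le_integral => //.
- exact: integrable_poisson_ffact_sum.
- apply: (@le_integrable _ _ _ _ _ measurableT _ (EFin \o cst rate)) => //.
  + move=> x _ /=; rewrite lee_fin [leRHS]ger0_norm ?(ltW rate0)//.
    rewrite ger0_norm; last by rewrite le_max lexx orbT.
    by rewrite ge_max (ltW rate0) andbT; have := ler0n R x; lra.
  + exact: finite_measure_integrable_cst.
move=> x _; rewrite lee_fin.
rewrite [leRHS](_ : _ = Num.max (- (x%:R - rate)) 0); last first.
  by congr Num.max; ring.
apply: le_trans (deficit_ge_poly _ _ _ u0).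
rewrite !big_ord_recr big_ord0/= !natr_ffactSr ffactn0 /a/=.
rewrite le_eqVlt; apply/orP; left; apply/eqP; ring.
Qed.

(** * Upper bound on the risk *)

Lemma sqr_sum_le (R : realFieldType) (n : nat) (d : 'I_n -> R) :
  (\sum_(i < n) d i) ^+ 2 <= n%:R * \sum_(i < n) d i ^+ 2.
Proof.
(* Symmetrizing into a double sum reduces Cauchy-Schwarz to 2 d_i d_j <= d_i^2 + d_j^2 term by
   term. *)
have -> : n%:R * \sum_(i < n) d i ^+ 2 =
    \sum_(i < n) \sum_(j < n) (d i ^+ 2 + d j ^+ 2) / 2.
  under [RHS]eq_bigr => i _.
    rewrite -mulr_suml big_split/= sumr_const card_ord; over.
  rewrite -mulr_suml big_split/= sumr_const card_ord sumrMnl.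
  by rewrite -(mulr_natl (\sum_(i < n) d i ^+ 2)); lra.
rewrite expr2 mulr_suml; apply: ler_sum => i _.
rewrite mulr_sumr; apply: ler_sum => j _.
have := sqr_ge0 (d i - d j); lra.
Qed.

(** The weight q on the left cancels the variance q/n of x = X/n, leaving a multiple of p, which is
    summable over the symbols. *)
Lemma sqr_excess_diff_le (R : realFieldType) (c p q x : R) :
  0 < c -> 0 <= p -> 0 <= q -> 0 <= x ->
  q * (Num.max (p - c * x) 0 - Num.max (p - c * q) 0) ^+ 2
    <= 2 * c * p * (x - q) ^+ 2.
Proof.
move=> c0 p0 q0 x0.
have [cq|cq] := leP (c * q) (2 * p).
  have lip : (Num.max (p - c * x) 0 - Num.max (p - c * q) 0) ^+ 2
      <= c ^+ 2 * (x - q) ^+ 2.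
    rewrite -exprMn mulrBr; move: (c * x) (c * q) => a b.
    have ab0 := sqr_ge0 (a - b).
    have [h1|h1] := leP (p - a) 0; have [h2|h2] := leP (p - b) 0.
    - lra.
    - have h3 : 0 <= (p - b) * (a - p) by apply: mulr_ge0; lra.
      have := sqr_ge0 (a - p); lra.
    - have h3 : 0 <= (p - a) * (b - p) by apply: mulr_ge0; lra.
      have := sqr_ge0 (b - p); lra.
    - lra.
  apply: (@le_trans _ _ (q * (c ^+ 2 * (x - q) ^+ 2))); first exact: ler_wpM2l.
  have := mulr_ge0 (ltW c0) (sqr_ge0 (x - q)); nra.
rewrite [X in _ - X]max_r; last by lra.
rewrite subr0; have [h|h] := leP (p - c * x) 0.
  rewrite expr0n/= mulr0; apply: mulr_ge0 (sqr_ge0 _).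
  by rewrite !mulr_ge0// ltW.
(* With f = p - c x, the chain is c q f^2 <= c q p^2 <= (c q)^2 p / 2 = 2 p (c q / 2)^2 <= 2 p c^2
   (q - x)^2, using 2 p < c q and c x < p. *)
rewrite -(ler_pM2l c0).
have h1 : (p - c * x) ^+ 2 <= p ^+ 2.
  have : 0 <= c * x by rewrite mulr_ge0// ltW.
  nra.
have h2 : (c * q / 2) ^+ 2 <= (c * (q - x)) ^+ 2 by nra.
have h3 := ler_wpM2l (mulr_ge0 (ltW c0) q0) h1.
have h4 := ler_wpM2l p0 h2.
have h5 : (c * q) * p * (2 * p) <= (c * q) * p * (c * q).
  by apply: ler_wpM2l; [rewrite !mulr_ge0// ltW|exact: ltW].
lra.
Qed.

Lemma integral_poisson_excess_le (R : realType) (n : nat) (c p q : R) :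
  (0 < n)%N -> 0 < c -> 0 <= p -> 0 <= q ->
  (\int[poisson_prob (n%:R * q) 0]_x
     ((Num.max (p - c * (x%:R / n%:R)) 0 - Num.max (p - c * q) 0) ^+ 2)%:E
   <= (2 * c * p / n%:R)%:E)%E.
Proof.
move=> n0 c0 p0 q0.
have nR0 : 0 < n%:R :> R by rewrite ltr0n.
(* At q = 0 the count is almost surely 0, so both excesses equal p and the integrand vanishes
   there. *)
move: q0; rewrite le_eqVlt => /predU1P[<-|q0].
  rewrite mulr0 (@eq_measure_integral _ _ _ _ (\d_0%N)); last first.
    by move=> A _ _; rewrite /= /poisson_prob ltxx.
  rewrite integral_dirac//= mul0r !mulr0 subrr expr0n mule0 lee_fin.
  by rewrite !mulr_ge0 ?invr_ge0// ltW.
have rate0 : 0 < n%:R * q by rewrite mulr_gt0.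
(* The pointwise bound divided by q, with x/n - q written as (x - n q)/n; the variance n q then
   gives K n q = 2 c p / n. *)
pose K := 2 * c * p / (q * n%:R ^+ 2).
have K0 : 0 <= K by rewrite /K !mulr_ge0 ?invr_ge0 ?mulr_ge0 ?exprn_ge0// ltW.
apply: (@le_trans _ _ (\int[poisson_prob (n%:R * q) 0]_x
    (K%:E * ((x%:R - n%:R * q) ^+ 2)%:E))%E).
  apply: ge0_le_integral => //.
  - by move=> x _; rewrite lee_fin sqr_ge0.
  - move=> x _; rewrite -EFinM lee_fin.
    have := sqr_excess_diff_le _ _ _ _ (x%:R / n%:R) c0 p0 (ltW q0).
    rewrite divr_ge0// => /(_ isT) h.
    rewrite -(ler_pM2l q0); apply: (le_trans h).
    rewrite le_eqVlt; apply/orP; left; apply/eqP; rewrite /K.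
    by field; rewrite !gt_eqF.
rewrite ge0_integralZl_EFin//; last by move=> x _; rewrite lee_fin sqr_ge0.
rewrite integral_poisson_variance// -EFinM lee_fin /K.
rewrite le_eqVlt; apply/orP; left; apply/eqP.
by field; rewrite !gt_eqF.
Qed.

Lemma measurable_fun_tnth_nat (R : realType) (S : nat) (i : 'I_S)
    (f : nat -> \bar R) :
  measurable_fun [set: S.-tuple nat] (fun x => f (tnth x i)).
Proof. by apply: measurableT_comp => //; exact: measurable_tnth. Qed.

Lemma measurable_hockey_stick_empirical (R : realType) (S n : nat) (eps : R)
    (p : 'I_S -> R) :
  measurable_fun [set: S.-tuple nat]
    (fun x => hockey_stick eps p (empirical n x)).
Proof.
apply: measurable_sum => i.
apply: (measurableT_comp (f := fun k : nat =>
  Num.max (p i - expR eps * (k%:R / n%:R)) 0)) => //.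
exact: measurable_tnth.
Qed.

Lemma plugin_risk_le (R : realType) (S n : nat) (eps : R) (p q : 'I_S -> R) :
  (0 < n)%N -> simplex R S p -> simplex R S q ->
  (plugin_risk eps n p q <= (2 * (expR eps * S%:R / n%:R))%:E)%E.
Proof.
move=> n0 [p0 p1] [q0 _]; rewrite /plugin_risk unlock.
pose d i k := Num.max (p i - expR eps * (k%:R / n%:R)) 0
  - Num.max (p i - expR eps * q i) 0.
have md i : measurable_fun [set: S.-tuple nat]
    (fun x => (d i (tnth x i) ^+ 2)%:E).
  exact: (measurable_fun_tnth_nat _ _ _ (fun k => (d i k ^+ 2)%:E)).
apply: (@le_trans _ _ (\int[poisson_counts n q]_x
    (S%:R%:E * \sum_(i < S) (d i (tnth x i) ^+ 2)%:E))%E).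
  apply: ge0_le_integral => //.
  - apply/measurable_EFinP; apply: measurable_funX.
    apply: measurableT_comp => //.
    by apply: measurable_funB => //; exact: measurable_hockey_stick_empirical.
  - by apply: measurable_funeM; exact: emeasurable_sum.
  - move=> x _; rewrite sumEFin -EFinM lee_fin real_normK ?num_real//.
    by rewrite /hockey_stick -sumrB; exact: sqr_sum_le.
rewrite ge0_integralZl_EFin//; first last.
- exact: emeasurable_sum.
- by move=> x _; apply: sume_ge0 => i _; rewrite lee_fin sqr_ge0.
rewrite ge0_integral_sum//; last by move=> i x _; rewrite lee_fin sqr_ge0.
rewrite [leRHS](_ : _ =
    S%:R%:E * \sum_(i < S) (2 * expR eps * p i / n%:R)%:E)%E; last first.
  rewrite sumEFin -EFinM; congr EFin.
  by rewrite -mulr_suml -mulr_sumr p1; ring.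
apply: lee_wpmul2l; first by rewrite lee_fin.
apply: lee_sum => i _.
rewrite (integral_prod_prob_tnth _ _ _ _ _ i (fun k => (d i k ^+ 2)%:E))//.
  by apply: integral_poisson_excess_le => //; exact: expR_gt0.
by move=> k; rewrite lee_fin sqr_ge0.
Qed.

(** * Lower bound on the risk *)

Lemma le_plugin_risk (R : realType) (S n : nat) (eps : R) (p q : 'I_S -> R)
    (t : R) :
  0 <= t -> hockey_stick eps p q = 0 ->
  (t%:E <= \sum_(i < S) \int[poisson_prob (n%:R * q i) 0]_k
      (Num.max (p i - expR eps * (k%:R / n%:R)) 0)%:E)%E ->
  ((t ^+ 2)%:E <= plugin_risk eps n p q)%E.
Proof.
move=> t0 d0 tE; rewrite /plugin_risk unlock d0.
pose f i k := Num.max (p i - expR eps * (k%:R / n%:R)) 0.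
pose Z x := hockey_stick eps p (empirical n x).
have f0 i k : 0 <= f i k by rewrite le_max lexx orbT.
have Z0 x : 0 <= Z x by apply: sumr_ge0 => i _; exact: f0.
have mZ : measurable_fun setT Z by exact: measurable_hockey_stick_empirical.
have EZ : (t%:E <= \int[poisson_counts n q]_x (Z x)%:E)%E.
  apply: (le_trans tE).
  under eq_integral do rewrite /Z /hockey_stick -sumEFin.
  rewrite ge0_integral_sum//.
  - apply: lee_sum => i _.
    rewrite (integral_prod_prob_tnth _ _ _ _ _ i (fun k => (f i k)%:E))//.
    by move=> k; rewrite lee_fin.
  - by move=> i; exact: (measurable_fun_tnth_nat _ _ _ (fun k => (f i k)%:E)).
  - by move=> i x _; rewrite lee_fin; exact: f0.
(* Jensen's inequality by integrating 2 t Z <= Z^2 + t^2; the finite term t^2 can be cancelled in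
   [\bar R] even before the risk is known to be finite. *)
suff h : ((2 * t ^+ 2)%:E <= \int[poisson_counts n q]_x (`|Z x - 0| ^+ 2)%:E
     + (t ^+ 2)%:E)%E.
  rewrite -(@leeD2rE _ (t ^+ 2)%:E)//; apply: le_trans h.
  by rewrite -EFinD lee_fin; lra.
have mZ2 : measurable_fun setT (fun x => (`|Z x - 0| ^+ 2)%:E).
  apply/measurable_EFinP; apply: measurable_funX; apply: measurableT_comp => //.
  exact: measurable_funB.
apply: (@le_trans _ _ (\int[poisson_counts n q]_x ((2 * t)%:E * (Z x)%:E))%E).
  rewrite ge0_integralZl_EFin//; first last.
  - by rewrite mulr_ge0.
  - exact/measurable_EFinP.
  - by move=> x _; rewrite lee_fin.
  rewrite (_ : 2 * t ^+ 2 = 2 * t * t); last by ring.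
  by rewrite EFinM; apply: lee_wpmul2l; rewrite // lee_fin mulr_ge0.
rewrite [leRHS](_ : _ = \int[poisson_counts n q]_x
    ((`|Z x - 0| ^+ 2)%:E + (t ^+ 2)%:E))%E; last first.
  rewrite ge0_integralD//.
    rewrite (integral_cst _ measurableT (t ^+ 2)%:E).
    by rewrite [X in (_ * X)%E]probability_setT mule1.
  by move=> x _; rewrite lee_fin sqr_ge0.
apply: ge0_le_integral => //.
- by move=> x _; rewrite -EFinM lee_fin !mulr_ge0.
- by apply: measurable_funeM; exact/measurable_EFinP.
- exact: emeasurable_funD.
move=> x _; rewrite -EFinM -EFinD lee_fin subr0 real_normK ?num_real//.
have := sqr_ge0 (Z x - t); lra.
Qed.

Definition matched_distribution (R : realType) (m : nat) (c : R)
    (i : 'I_m.+2) : R :=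
  if i == ord_max then 1 - m.+1%:R / (c * m.+2%:R) else 1 / (c * m.+2%:R).

Lemma matched_distribution_simplex (R : realType) (m : nat) (c : R) :
  1 <= c -> simplex R m.+2 (matched_distribution R m c).
Proof.
move=> c1; set S := m.+2.
have S0 : 0 < S%:R :> R by rewrite ltr0n.
have cS : S%:R <= c * S%:R by rewrite ler_peMl// ltW.
split.
  move=> i; rewrite /matched_distribution; case: ifP => _; last first.
    by rewrite divr_ge0// (le_trans _ cS)// ltW.
  rewrite subr_ge0 ler_pdivrMr ?mul1r ?(lt_le_trans S0)//.
  by apply: le_trans cS; rewrite ler_nat.
rewrite big_ord_recr/= {2}/matched_distribution eqxx.
rewrite (eq_bigr (fun=> 1 / (c * S%:R))); last first.
  move=> i _; rewrite /matched_distribution ifF//.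
  by apply/negbTE; rewrite -val_eqE/= ltn_eqF.
rewrite sumr_const card_ord -(mulr_natl (1 / (c * S%:R))) mulrA mulr1.
by rewrite addrC subrK.
Qed.

Lemma uniform_simplex (R : realType) (m : nat) :
  simplex R m.+1 (fun=> 1 / m.+1%:R).
Proof.
split; first by move=> i; rewrite divr_ge0.
rewrite sumr_const card_ord -(mulr_natl (1 / m.+1%:R)) mulrA mulr1.
by rewrite mulfV// pnatr_eq0.
Qed.

Lemma matched_plugin_risk_ge (R : realType) (m n : nat) (eps : R) :
  0 <= eps -> (0 < n)%N -> expR eps * m.+2%:R <= n%:R ->
  ((9 / 4096 * (expR eps * m.+2%:R / n%:R))%:E <=
   plugin_risk eps n (fun=> 1 / m.+2%:R)%R
     (matched_distribution R m (expR eps)))%E.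
Proof.
move=> eps0 n0 nbig; set c := expR eps.
have c1 : 1 <= c by rewrite -expR0 ler_expR.
have c0 : 0 < c by lra.
set s : R := m.+2%:R.
have s2 : 2 <= s by rewrite ler_nat.
have nR0 : 0 < n%:R :> R by rewrite ltr0n.
set N : R := n%:R in nbig nR0 *.
have cs0 : 0 < c * s by rewrite mulr_gt0//; lra.
pose lam := N / (c * s).
(* The sample size assumption n >= c S says exactly that the Poisson rate is at least 1, as the
   deficit bound requires. *)
have lam1 : 1 <= lam by rewrite /lam ler_pdivlMr// mul1r.
pose r := Num.sqrt lam.
have r2 : r ^+ 2 = lam by rewrite sqr_sqrtr//; lra.
have mE : m.+1%:R = s - 1 :> R by rewrite /s -[m.+2]addn1 natrD addrK.
(* The s - 1 matched symbols each contribute c/N times the deficit bound. Squaring gives (3/32)^2 =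
   9/1024, and ((s - 1)/s)^2 >= 1/4 for s >= 2 gives 9/4096. *)
pose t := (s - 1) * (c / N * (3 / 32 * r)).
have r0 : 0 <= r := sqrtr_ge0 _.
have cN0 : 0 <= c / N by rewrite divr_ge0// ltW.
have t0 : 0 <= t by apply: mulr_ge0; [|apply: mulr_ge0 => //]; lra.
apply: (@le_trans _ _ (t ^+ 2)%:E).
  rewrite lee_fin [leRHS](_ : _ = (s - 1) ^+ 2 * (c / N) ^+ 2 * (9 / 1024)
     * r ^+ 2); last by rewrite /t; field; rewrite gt_eqF.
  rewrite r2 [leRHS](_ : _ = (9 / 1024) * ((s - 1) / s) ^+ 2 * (c * s / N));
    last first.
    rewrite /lam; field; rewrite !gt_eqF//; lra.
  apply: ler_wpM2r; first by rewrite divr_ge0// ltW.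
  have : 1 / 2 <= (s - 1) / s by rewrite ler_pdivlMr; lra.
  move: ((s - 1) / s) => w w2; nra.
apply: le_plugin_risk => //.
  rewrite /hockey_stick big1// => i _; apply: max_r.
  rewrite /matched_distribution mE -/c -/s; case: ifP => _.
    rewrite [leLHS](_ : _ = 1 - c); first by lra.
    field; rewrite !gt_eqF//; lra.
  rewrite [leLHS](_ : _ = 0)//; field; rewrite !gt_eqF//; lra.
(* The last symbol's contribution is nonnegative and is dropped. *)
rewrite big_ord_recr/= -[t%:E]adde0; apply: leeD; last first.
  by apply: integral_ge0 => x _; rewrite lee_fin le_max lexx orbT.
apply: (@le_trans _ _ (\sum_(i < m.+1) (c / N * (3 / 32 * r))%:E)%E).
  by rewrite sumEFin sumr_const card_ord -(mulr_natl (c / N * (3 / 32 * r))) mE.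
apply: lee_sum => i _; rewrite /matched_distribution ifF; last first.
  by apply/negbTE; rewrite -val_eqE/= ltn_eqF.
rewrite -/c -/s -/N (_ : N * (1 / (c * s)) = lam); last by rewrite mul1r.
(* Since 1/s = (c/N) lam, the excess is c/N times the Poisson deficit. *)
under eq_integral => k _.
  rewrite (_ : Num.max _ _ = c / N * Num.max (lam - k%:R) 0); last first.
    rewrite maxr_pMr// mulr0; congr Num.max; rewrite /lam.
    field; rewrite !gt_eqF//; lra.
  rewrite EFinM; over.
rewrite /= ge0_integralZl_EFin//; last first.
  by move=> k _; rewrite lee_fin le_max lexx orbT.
rewrite EFinM; apply: lee_wpmul2l; first by rewrite lee_fin.
exact: integral_poisson_deficit_ge.
Qed.

Theorem corollary2 (R : realType) :
  exists A a : R, [/\ 0 < A, 0 < a &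
    forall (eps : R) (S n : nat),
      0 <= eps -> (2 <= S)%N -> (0 < n)%N -> expR eps * S%:R <= n%:R ->
      ((a * (expR eps * S%:R / n%:R))%:E <=
        ereal_sup [set plugin_risk eps n p q
                  | p in simplex R S & q in simplex R S] <=
        (A * (expR eps * S%:R / n%:R))%:E)%E].
Proof.
exists 2, (9 / 4096); split; [lra|lra|] => eps S n eps0 S2 n0 nbig.
apply/andP; split.
  case: S S2 nbig => [|[|m]]// _ nbig.
  have h := matched_plugin_risk_ge _ m n eps eps0 n0 nbig; apply: (le_trans h).
  apply: ereal_sup_ubound => /=; exists (fun=> 1 / m.+2%:R).
    exact: uniform_simplex.
  exists (matched_distribution R m (expR eps)) => //.
  by apply: matched_distribution_simplex; rewrite -expR0 ler_expR.
apply: ge_ereal_sup => _ [p sp [q sq <-]]; exact: plugin_risk_le.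
Qed.
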